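(* Assume that $P_X \ll \nu$, where $\nu(dx)=\nu_1(dx_1)\otimes\cdots\otimes\nu_p(dx_p)$, and that there exists $0<M\le 1$ such that for every $u\subseteq \{1,\dots,p\}$, $p_X \ge M\, p_{X_u}p_{X_{u^c}}$ $\nu$-a.e. Let $\eta$ be any function in $L^2_{\mathbb R}(\mathbb R^p,\mathcal B(\mathbb R^p),P_X)$. Then there exist functions $(\eta_u)_{u\in S}$ with $\eta_u\in H_u^0$ for every $u\in S$ (where $H_\emptyset^0=H_\emptyset$ is the space of constants) such that $$\eta(X_1,\dots,X_p)=\sum_{u\in S}\eta_u(X_u).$$ Moreover, this decomposition is unique.
   Context: Let $(\Omega,\mathcal A,P)$ be a probability space, $p\ge 1$, $\mathbf X=(X_1,\dots,X_p)$ a random vector in $\mathbb R^p$ with law $P_X$ (the pushforward of $P$ by $\mathbf X$). $\nu$ is a $\sigma$-finite measure on $(\mathbb R^p,\mathcal B(\mathbb R^p))$ and $p_X=dP_X/d\nu$. $S$ is the collection of all subsets of $\{1,\dots,p\}$. For $u\in S$, $X_u=(X_l)_{l\in u}$, $u^c$ is the complement of $u$ in $\{1,\dots,p\}$, and $p_{X_u}$ is the marginal density of $X_u$ with respect to $\bigotimes_{l\in u}\nu_l$ (with $p_{X_\emptyset}=1$). The inner product of $L^2_{\mathbb R}(\mathbb R^p,\mathcal B(\mathbb R^p),P_X)$ is $\langle h_1,h_2\rangle=\mathbb E(h_1(\mathbf X)h_2(\mathbf X))$. Functions are identified when equal $P_X$-a.s. $H_u$ is the subspace of square integrable measurable functions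 depending only on $X_u$; $H_\emptyset$ is the set of constants and $H_\emptyset^0=H_\emptyset$. For $u\in S\setminus\{\emptyset\}$, recursively, $$H_u^0=\{h_u(X_u)\in H_u:\ \langle h_u,h_v\rangle=0\ \ \forall v\subset u,\ \forall h_v\in H_v^0\},$$ where $\subset$ denotes strict inclusion. *)

(* Defs.v *)
From HB Require Import structures.
From mathcomp Require Import all_boot all_order all_algebra.
From mathcomp Require Import all_classical all_reals all_analysis.
From mathcomp Require Import zify.

Set Implicit Arguments.
Unset Strict Implicit.
Unset Printing Implicit Defensive.

Import Order.TTheory GRing.Theory Num.Theory.
Import numFieldNormedType.Exports.

Local Open Scope classical_set_scope.
Local Open Scope ring_scope.

Section cons_pair.
Context d (T : measurableType d) (n : nat).

Definition cons_pair (z : n.-tuple T * T) : n.+1.-tuple T :=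
  [tuple of z.2 :: z.1].

Lemma measurable_cons_pair : measurable_fun [set: n.-tuple T * T] cons_pair.
Proof. exact: (measurable_cons measurable_snd measurable_fst). Qed.

End cons_pair.

Section tuple_product_measure.
Local Open Scope ereal_scope.
Context d (T : measurableType d) (R : realType).

Section prod_cons.
Context (n : nat) (mu : {measure set (n.-tuple T) -> \bar R})
  (m0 : {sigma_finite_measure set T -> \bar R}).

(* The image of mu (x) m0 under (t, x) |-> x :: t. The tail comes first because
   `\x` asks for sigma-finiteness of its second factor only. *)
Definition prod_cons : set (n.+1.-tuple T) -> \bar R :=
  pushforward (mu \x m0) (@cons_pair _ T n).

Let prod_cons0 : prod_cons set0 = 0.
Proof. by rewrite /prod_cons /pushforward preimage_set0 measure0. Qed.

Let prod_cons_ge0 A : 0 <= prod_cons A.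
Proof. by apply: integral_ge0 => *; exact: measure_ge0. Qed.

Let prod_cons_sigma_additive : semi_sigma_additive prod_cons.
Proof.
pose m := measure_function_pushforward__canonical__measure_function_Measure
    (mu \x m0)%E (@measurable_cons_pair _ T n).
exact: (@measure_semi_sigma_additive _ _ _ m).
Qed.

HB.instance Definition _ := isMeasure.Build _ _ _ prod_cons
  prod_cons0 prod_cons_ge0 prod_cons_sigma_additive.

End prod_cons.

(* The product measure m_0 (x) ... (x) m_(n-1) on n.-tuple T (a point mass for
   n = 0); see [tprod_box] and [tprod_sigma_finite]. *)
Fixpoint tprod_measure (n : nat) :
    ('I_n -> {sigma_finite_measure set T -> \bar R}) ->
    {measure set (n.-tuple T) -> \bar R} :=
  match n with
  | 0 => fun=> dirac [tuple]
  | n'.+1 => fun m =>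
      prod_cons (tprod_measure (fun i => m (lift ord0 i))) (m ord0)
  end.

Definition tprod (n : nat) (m : 'I_n -> {sigma_finite_measure set T -> \bar R})
  : set (n.-tuple T) -> \bar R := tprod_measure m.

HB.instance Definition _ n m := Measure.on (@tprod n m).

Definition box n (A : 'I_n -> set T) : set (n.-tuple T) :=
  [set t | forall i, A i (tnth t i)].

Lemma measurable_box n (A : 'I_n -> set T) :
  (forall i, measurable (A i)) -> measurable (box A).
Proof.
move=> mA.
have -> : box A = \bigcap_(i in [set: 'I_n]) ((@tnth n T ^~ i) @^-1` A i).
  by apply/seteqP; split => [t At i _|t At i]; [exact: At|exact: (At i I)].
apply: fin_bigcap_measurable => // i _.
by rewrite -[X in measurable X]setTI; exact: measurable_tnth.
Qed.

Lemma tprod_box n (m : 'I_n -> {sigma_finite_measure set T -> \bar R})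
    (A : 'I_n -> set T) : (forall i, measurable (A i)) ->
  tprod m (box A) = \prod_(i < n) m i (A i).
Proof.
elim: n m A => [|n IHn] m A mA.
  by rewrite big_ord0 /tprod /= diracE mem_set// => -[].
rewrite big_ord_recl muleC -(IHn (fun i => m (lift ord0 i)))//.
rewrite /tprod /= /prod_cons /pushforward.
have -> : @cons_pair _ T n @^-1` box A =
    box (fun i => A (lift ord0 i)) `*` A ord0.
  apply/seteqP; split => -[t x] /=.
    move=> Atx; split=> [i|]; last exact: (Atx ord0).
    by have := Atx (lift ord0 i); rewrite tnthS.
  move=> [At Ax] i; case: (unliftP ord0 i) => [j|] -> //.
  by rewrite tnthS; exact: At.
by rewrite product_measure1E//; exact: measurable_box.
Qed.

Lemma tprod_sigma_finite n
    (m : 'I_n -> {sigma_finite_measure set T -> \bar R}) :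
  sigma_finite setT (tprod m).
Proof.
have F i : {F : (set T)^nat | [/\ setT = \bigcup_k F k, nondecreasing_seq F &
    forall k, measurable (F k) /\ m i (F k) < +oo]}.
  apply: cid; have /sigma_finiteP[F [FT ndF mF]] := sigma_finiteT (m i).
  by exists F.
exists (fun k => box (fun i => sval (F i) k)).
  apply/esym; rewrite -subTset => t _.
  have kP i : {k | sval (F i) k (tnth t i)}.
    apply: cid; case: (svalP (F i)) => FT _ _.
    have : [set: T] (tnth t i) by [].
    by rewrite {1}FT => -[k _ ?]; exists k.
  exists (\max_(i < n) sval (kP i))%N => // i.
  case: (svalP (F i)) => _ ndF _.
  have /ndF/subsetPset := @leq_bigmax 'I_n (fun i => sval (kP i)) i.
  by apply; exact: svalP (kP i).
move=> k; have mF i : measurable (sval (F i) k).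
  by case: (svalP (F i)) => _ _ /(_ k)[].
split; first exact: measurable_box.
rewrite tprod_box// ltey_eq.
apply/orP; left; apply: (big_ind (fun x => x \is a fin_num)) => //.
  by move=> x y; exact: fin_numM.
move=> i _; rewrite ge0_fin_numE ?measure_ge0//.
by case: (svalP (F i)) => _ _ /(_ k)[].
Qed.

HB.instance Definition _ n m :=
  @Measure_isSigmaFinite.Build _ _ _ (@tprod n m) (@tprod_sigma_finite n m).

End tuple_product_measure.

Section subvector.
Context d (T : measurableType d) (p : nat) (u : {set 'I_p}).

(* x |-> x_u, the coordinates of x in u listed in increasing order. *)
Definition subvec (x : p.-tuple T) : #|u|.-tuple T :=
  [tuple tnth x (enum_val i) | i < #|u|].

Lemma measurable_subvec : measurable_fun [set: p.-tuple T] subvec.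
Proof.
apply/measurable_fun_tnthP => i.
rewrite (_ : _ \o _ = @tnth p T ^~ (enum_val i)); first exact: measurable_tnth.
by apply/funext => x /=; rewrite tnth_mktuple.
Qed.

HB.instance Definition _ :=
  isMeasurableFun.Build _ _ _ _ subvec measurable_subvec.

End subvector.
Arguments subvec {d T p}.

Section density.
Context d (Omega : measurableType d) d' (T : measurableType d') (R : realType).

(* A fixed version of dP_X/dnu; it is only meaningful when P_X << nu, and is
   constantly -oo otherwise. *)
Definition density (P : probability Omega R) (X : {mfun Omega >-> T})
    (nu : {sigma_finite_measure set T -> \bar R}) : T -> \bar R :=
  Radon_Nikodym (charge_of_finite_measure (distribution P X)) nu.

End density.

(* R^p is [p.-tuple R] with the product sigma-algebra, i.e. the Borel one. *)
Section hoeffding_spaces.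
Context d (Omega : measurableType d) (R : realType) (P : probability Omega R).
Context (p : nat) (X : {RV P >-> p.-tuple R}).

Definition marginal_density
    (nu : 'I_p -> {sigma_finite_measure set R -> \bar R}) (u : {set 'I_p}) :
    #|u|.-tuple R -> \bar R :=
  density P (subvec u \o X) (tprod (fun i : 'I_#|u| => nu (enum_val i))).

Lemma marginal_density_set0 nu x : @marginal_density nu finset.set0 x = 1%E.
Proof.
rewrite /marginal_density.
move: (fun i => nu _) x; move: (subvec _ \o X : {mfun _ >-> _}).
rewrite (cards0 'I_p) => Y m x.
have tprodE : tprod m = dirac x :> (set (0.-tuple R) -> \bar R).
  by rewrite /tprod /= (tuple0 x).
have Ym : charge_of_finite_measure (distribution P Y) `<< tprod m.
  move=> A A0 B mB BA.
  have [->|/set0P[t Bt]] := eqVneq B set0; first exact: measure0.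
  have := A0 B mB BA; rewrite tprodE diracE mem_set ?(tuple0 x) -?(tuple0 t)//.
  by move=> /eqP; rewrite onee_eq0.
have := Radon_Nikodym_integral Ym measurableT.
rewrite [X in X = _ -> _](_ : _ = 1%E); last exact: probability_setT.
rewrite (eq_measure_integral (dirac x)); last first.
  by move=> A _ _; exact: (congr1 (@^~ A) tprodE).
have mf := measurable_int _ (Radon_Nikodym_integrable Ym).
rewrite (integral_dirac x measurableT mf).
by rewrite diracT mul1e; exact: esym.
Qed.

(* Elements of L^2 are represented by functions on R^p, not by classes modulo
   P_X-a.s. equality; a function of X_u is a function of x factoring through
   [subvec u]. *)
Definition inner (h1 h2 : p.-tuple R -> R) : \bar R :=
  'E_P[fun w => h1 (X w) * h2 (X w)].

Definition Hspace (u : {set 'I_p}) : set (p.-tuple R -> R) :=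
  [set h | h \in Lfun (distribution P X) 2%:E /\
     exists2 g : #|u|.-tuple R -> R,
       measurable_fun [set: #|u|.-tuple R] g & h = g \o subvec u].

(* H_u^0 is defined by recursion on the strict inclusion of sets; the argument n
   is only fuel, see [Hspace0E]. *)
Fixpoint Hspace0_rec (n : nat) (u : {set 'I_p}) : set (p.-tuple R -> R) :=
  match n with
  | 0 => Hspace u
  | n'.+1 => [set h | Hspace u h /\
      forall v : {set 'I_p}, v \proper u ->
      forall hv, Hspace0_rec n' v hv -> inner h hv = 0%E]
  end.

Definition Hspace0 (u : {set 'I_p}) : set (p.-tuple R -> R) :=
  Hspace0_rec #|u| u.

Lemma Hspace0_rec_fuel n (u : {set 'I_p}) : (#|u| <= n)%N ->
  Hspace0_rec n u = Hspace0 u.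
Proof.
rewrite /Hspace0; have [k] := ubnP #|u|.
elim: k n u => // k IHk n u uk un.
case: n un => [|n] un; first by move: un; rewrite leqn0 => /eqP ->.
case E : #|u| => [|m] /=.
  apply/seteqP; split => h //=; first by case.
  move=> Hh; split => // v /proper_card; by rewrite E.
apply/seteqP; split => h /= [Hh orth]; split => // v vu hv;
  have vu' := proper_card vu; (have vk : (#|v| < k)%N by lia);
  by move=> Hhv; apply: (orth v vu); move: Hhv; rewrite !IHk//; lia.
Qed.

Lemma Hspace0E (u : {set 'I_p}) : Hspace0 u =
  [set h | Hspace u h /\ forall v : {set 'I_p}, v \proper u ->
                          forall hv, Hspace0 v hv -> inner h hv = 0%E].
Proof.
rewrite -(@Hspace0_rec_fuel #|u|.+1 u)//=.
apply/seteqP; split => h /= [Hh orth]; split => // v vu hv Hhv;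
  apply: (orth v vu); move: Hhv;
  by rewrite Hspace0_rec_fuel// ltnW// proper_card.
Qed.

Lemma Hspace_set0 : Hspace finset.set0 = range (fun c : R => cst c).
Proof.
apply/seteqP; split => [h [_ [g _ ->]]|_ [c _ <-]].
  exists (g (subvec finset.set0 [tuple (0 : R) | _ < p])) => //.
  apply/funext => x /=; congr g; apply/eq_from_tnth => i.
  by have := leq_trans (ltn_ord i) (eq_leq (cards0 _)).
split; last by exists (cst c).
exact: Lfun_cst.
Qed.

Lemma Hspace0_set0 : Hspace0 finset.set0 = Hspace finset.set0.
Proof. by rewrite /Hspace0 cards0. Qed.

End hoeffding_spaces.
Arguments marginal_density {d Omega R P p} X nu u.

(* Main.v *)
Require Import Defs.
From HB Require Import structures.
From mathcomp Require Import all_boot all_order all_algebra.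
From mathcomp Require Import all_classical all_reals all_analysis.
From mathcomp Require Import measurable_realfun.
From mathcomp Require Import ring lra zify.

Set Implicit Arguments.
Unset Strict Implicit.
Unset Printing Implicit Defensive.

Import Order.TTheory GRing.Theory Num.Theory.
Import numFieldNormedType.Exports.

Local Open Scope classical_set_scope.
Local Open Scope ring_scope.

(** Let mu be the law of X, and equip L2(mu) with its inner product. Write H_u
    for the space of the functions of X_u.

    The density hypothesis says that mu dominates M times the product of its
    marginals on u and on the complement of u ([mix_integral_le]). From it comes
    the key inequality ([L2space_wide_angle]): if a in H_u is orthogonal to H_v
    for all v strictly included in u, and if b is a sum of functions b_v in H_v,
    for sets v that do not contain u, then |a + b|^2 >= M |a|^2. Indeed
    |a + b|^2 is at least M times the integral of (a + b)^2 under the product of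
    the marginals; freezing the variables outside u, a does not change, whereas
    b_v becomes a function of the variables of index in u :&: v, a strict subset
    of u, hence orthogonal to a.

    The rest is Hilbert space geometry, carried out in an abstract space with a
    semi-inner product ([hoeffding_ex], [hoeffding_unique]). The key inequality
    says that each H_u^0 makes a positive angle with the sum of any H_v^0 with v
    not containing u. Adding these spaces one at a time, by increasing
    cardinality of the index, the sums remain complete
    ([scomplete_add], [direct_sum_complete]). So a function of H_u can be
    projected on the sum of the H_v^0 with v strictly included in u, and the
    remainder is in H_u^0; by induction H_u is the sum of the H_v^0 with v
    included in u, and u = {1, ..., p} gives existence. Uniqueness is again the
    key inequality: in a null sum the components vanish one after the other,
    starting from the largest indices.

    Completeness of H_u comes from the proof that L2 is complete
    ([L2_fast_limit]), in which the limit is a pointwise limit and thus a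
    function of the same coordinates. *)

(** * Semi-inner products and complete subspaces *)

Record semi_inner (R : realType) (V : lmodType R) := SemiInner {
  form :> V -> V -> R;
  formC : forall x y, form x y = form y x;
  formDl : forall x y z, form (x + y) z = form x z + form y z;
  formZl : forall a x y, form (a *: x) y = a * form x y;
  form_ge0 : forall x, 0 <= form x x }.

Section semi_inner_theory.
Context (R : realType) (V : lmodType R) (B : semi_inner V).
Implicit Types (x y z : V) (A C : set V).

Lemma formDr x y z : B x (y + z) = B x y + B x z.
Proof. by rewrite formC formDl !(formC B x). Qed.

Lemma formZr a x y : B x (a *: y) = a * B x y.
Proof. by rewrite formC formZl (formC B x). Qed.

Lemma formNl x y : B (- x) y = - B x y.
Proof. by rewrite -scaleN1r formZl mulN1r. Qed.

Lemma formNr x y : B x (- y) = - B x y.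
Proof. by rewrite formC formNl formC. Qed.

Lemma form0l x : B 0 x = 0.
Proof. by rewrite -(scale0r (0 : V)) formZl mul0r. Qed.

Lemma form0r x : B x 0 = 0.
Proof. by rewrite formC form0l. Qed.

Lemma form_sumr (I : finType) (Q : pred I) (a : I -> V) x :
  B x (\sum_(i | Q i) a i) = \sum_(i | Q i) B x (a i).
Proof.
apply: (big_ind2 (fun s t => B x s = t)) => //; first exact: form0r.
by move=> s1 t1 s2 t2 <- <-; rewrite formDr.
Qed.

Lemma form_sqrD x y : B (x + y) (x + y) = B x x + 2 * B x y + B y y.
Proof. by rewrite formDl !formDr (formC B y x); ring. Qed.

Lemma form_sqrB x y : B (x - y) (x - y) = B x x - 2 * B x y + B y y.
Proof. by rewrite form_sqrD formNl !formNr; ring. Qed.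

Lemma form_CauchySchwarz x y : B x y ^+ 2 <= B x x * B y y.
Proof.
have pol t : 0 <= B x x + 2 * t * B x y + t ^+ 2 * B y y.
  have := form_ge0 B (x + t *: y).
  by rewrite form_sqrD !formZl !formZr !mulrA -expr2; lra.
have [y0|yN0] := eqVneq (B y y) 0.
  rewrite y0 mulr0.
  have := pol (- (B x x + 1) / (2 * B x y)).
  have [-> _|xy0] := eqVneq (B x y) 0; first by rewrite expr0n.
  rewrite y0 mulr0 addr0 (_ : 2 * _ * _ = - (B x x + 1)); last by field.
  rewrite opprD addrA subrr add0r oppr_ge0 => /le_lt_trans /(_ ltr01).
  by rewrite ltxx.
have yp : 0 < B y y by rewrite lt_neqAle eq_sym yN0 form_ge0.
have := pol (- B x y / B y y).
rewrite (_ : _ + _ = (B x x * B y y - B x y ^+ 2) / B y y); last by field.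
by rewrite pmulr_lge0 ?invr_gt0// subr_ge0.
Qed.

(** Null vectors are orthogonal to everything, so a semi-inner product may be
    used directly on functions, without passing to classes modulo a.e.
    equality. *)
Lemma form_null_l x y : B x x = 0 -> B x y = 0.
Proof.
move=> x0; apply/eqP; rewrite -sqrf_eq0 eq_le sqr_ge0 andbT.
by rewrite (le_trans (form_CauchySchwarz x y))// x0 mul0r.
Qed.

Definition snorm x := Num.sqrt (B x x).

Lemma snorm_ge0 x : 0 <= snorm x.
Proof. exact: sqrtr_ge0. Qed.

Lemma snorm_sqr x : snorm x ^+ 2 = B x x.
Proof. by rewrite sqr_sqrtr// form_ge0. Qed.

Lemma snormN x : snorm (- x) = snorm x.
Proof. by rewrite /snorm formNl formNr opprK. Qed.

Lemma snormB x y : snorm (x - y) = snorm (y - x).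
Proof. by rewrite -snormN opprB. Qed.

Lemma snorm0 : snorm 0 = 0.
Proof. by rewrite /snorm form0l sqrtr0. Qed.

Lemma form_le_snorm x y : `|B x y| <= snorm x * snorm y.
Proof.
rewrite -(ler_pXn2r (n := 2)) ?nnegrE ?mulr_ge0 ?snorm_ge0//.
by rewrite real_normK ?num_real// exprMn !snorm_sqr form_CauchySchwarz.
Qed.

Lemma ler_snormD x y : snorm (x + y) <= snorm x + snorm y.
Proof.
rewrite -(ler_pXn2r (n := 2)) ?nnegrE ?addr_ge0 ?snorm_ge0//.
rewrite sqrrD !snorm_sqr form_sqrD.
have := le_trans (ler_norm _) (form_le_snorm x y); lra.
Qed.

Lemma ler_snorm_dist x y z : snorm (x - z) <= snorm (x - y) + snorm (y - z).
Proof. by rewrite -[x - z](subrKA y) ler_snormD. Qed.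

(** The form in which limits are taken in the abstract part: all convergence is
    at a geometric rate, and this replaces the passage to the limit. *)
Lemma geometric_le0 (D r : R) : (forall n, r <= D / 2 ^+ n) -> r <= 0.
Proof.
move=> rD; rewrite leNgt; apply/negP => r0.
have [n Dn] : exists n : nat, D / r < n%:R.
  exists (Num.truncn `|D / r|).+1.
  by rewrite (le_lt_trans (ler_norm _))// truncnS_gt.
have := rD n; rewrite ler_pdivlMr ?exprn_gt0// leNgt => /negP; apply.
move: Dn; rewrite ltr_pdivrMr// mulrC => /lt_le_trans; apply.
by rewrite ler_pM2l// -natrX ler_nat ltnW// ltn_expl.
Qed.

Definition lin_subspace A := A 0 /\ forall a x y, A x -> A y -> A (a *: x + y).

(** Completeness tested on sequences with geometrically decreasing increments,
    whose limits are then reached at a geometric rate. Every Cauchy sequence has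
    such a subsequence, so this is the usual notion; in this form it needs no
    topology on V, and it is stable under sums of subspaces because an increment
    of a sum controls the increments of its two terms up to a constant. *)
Definition scomplete A := forall (x : nat -> V) (C : R),
  (forall n, A (x n)) -> (forall n, snorm (x n.+1 - x n) <= C / 2 ^+ n) ->
  exists2 y, A y & exists D, forall n, snorm (x n - y) <= D / 2 ^+ n.

Section subspace_theory.
Context (A : set V) (sA : lin_subspace A).

Lemma subspaceD x y : A x -> A y -> A (x + y).
Proof. by move=> Ax Ay; rewrite -[x]scale1r; apply: sA.2. Qed.

Lemma subspaceZ a x : A x -> A (a *: x).
Proof.
by move=> Ax; rewrite -[_ *: _]addr0; apply: sA.2 => //; exact: sA.1.
Qed.

Lemma subspaceN x : A x -> A (- x).
Proof. by rewrite -scaleN1r; exact: subspaceZ. Qed.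

Lemma subspaceB x y : A x -> A y -> A (x - y).
Proof. by move=> Ax Ay; apply: subspaceD => //; exact: subspaceN. Qed.

Lemma subspace_sum (I : finType) (Q : pred I) (a : I -> V) :
  (forall i, Q i -> A (a i)) -> A (\sum_(i | Q i) a i).
Proof.
by move=> Aa; apply: (big_ind A) => //; [exact: sA.1|exact: subspaceD].
Qed.

(** If k is a closest point to h, perturbing it by t *: k' gives the quadratic
    inequality 0 <= t ^+ 2 * B k' k' - 2 * t * b for all t, where b is
    B (h - k) k'; this forces b = 0. *)
Lemma min_dist_orthogonal h k : A k ->
  (forall k', A k' -> B (h - k) (h - k) <= B (h - k') (h - k')) ->
  forall k', A k' -> B (h - k) k' = 0.
Proof.
move=> Ak hk k' Ak'; set e := h - k; set b := B e k'.
have pol t : 0 <= t ^+ 2 * B k' k' - 2 * t * b.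
  have /hk : A (k + t *: k') by apply: subspaceD => //; exact: subspaceZ.
  rewrite opprD addrA (form_sqrB (h - k)) formZl !formZr -/e -/b !mulrA -expr2.
  lra.
(* The optimal t is b / B k' k'; adding 1 to the denominator keeps the choice
   meaningful for a null vector k', and still makes the bound negative. *)
have := pol (b / (B k' k' + 1)).
have p1 : 0 < B k' k' + 1 by rewrite ltr_wpDl ?form_ge0.
have -> : (b / (B k' k' + 1)) ^+ 2 * B k' k' - 2 * (b / (B k' k' + 1)) * b =
    - (b ^+ 2 * (B k' k' + 2) / (B k' k' + 1) ^+ 2).
  by field; rewrite gt_eqF.
rewrite oppr_ge0 pmulr_lle0 ?invr_gt0 ?exprn_gt0//.
rewrite pmulr_lle0 ?ltr_wpDl ?form_ge0// => b0.
by apply/eqP; rewrite -sqrf_eq0 eq_le b0 sqr_ge0.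
Qed.

(** A sequence almost minimizing the distance to h has small increments by the
    parallelogram identity, since midpoints stay in A; its limit is a closest
    point. *)
Lemma scomplete_projection h : scomplete A ->
  exists2 k, A k & forall k', A k' -> B (h - k) k' = 0.
Proof.
move=> cA.
pose E := [set B (h - k) (h - k) | k in A].
have E0 : E !=set0 by exists (B (h - 0) (h - 0)), 0 => //; exact: sA.1.
have lE : has_lbound E by exists 0 => _ [k _ <-]; exact: form_ge0.
pose d := inf E.
have dle k : A k -> d <= B (h - k) (h - k).
  by move=> Ak; apply: ge_inf => //; exists k.
have xP n : {k | A k /\ B (h - k) (h - k) <= d + (2 ^+ n ^+ 2)^-1}.
  apply: cid; have e0 : 0 < (2 ^+ n ^+ 2 : R)^-1 by rewrite invr_gt0 !exprn_gt0.
  have [_ [k Ak <-] kd] := inf_adherent e0 (conj E0 lE).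
  by exists k; split => //; exact: ltW.
(* Being within 4 ^- n of the infimum gives increments of norm 2 / 2 ^ n. *)
pose x n := sval (xP n).
have Ax n : A (x n) by have [] := svalP (xP n).
have xd n : B (h - x n) (h - x n) <= d + (2 ^+ n ^+ 2)^-1.
  by have [] := svalP (xP n).
have fast n : snorm (x n.+1 - x n) <= 2 / 2 ^+ n.
  rewrite -(ler_pXn2r (n := 2)) ?nnegrE ?snorm_ge0 ?divr_ge0 ?exprn_ge0//.
  rewrite snorm_sqr expr_div_n.
  have /dle : A (2^-1 *: (x n.+1 + x n)).
    by apply: subspaceZ; exact: subspaceD.
  have -> : h - 2^-1 *: (x n.+1 + x n) =
      2^-1 *: ((h - x n.+1) + (h - x n)).
    rewrite addrACA -opprD scalerBr (scalerDr _ h) -scalerDl.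
    by rewrite -div1r -splitr scale1r.
  have -> : x n.+1 - x n = (h - x n) - (h - x n.+1).
    by rewrite opprB [RHS]addrC subrKA.
  have := xd n; have := xd n.+1.
  set s := h - x n; set t := h - x n.+1.
  have : (2 ^+ n.+1 ^+ 2 : R)^-1 <= (2 ^+ n ^+ 2)^-1.
    rewrite lef_pV2 ?posrE ?exprn_gt0// -!exprM ler_weXn2l ?ler1n//.
    by rewrite leq_mul2r leqnSn orbT.
  rewrite formZl formZr (form_sqrB s t) (form_sqrD t s) (formC B t s).
  by set e := (_ ^+ _ ^+ _)^-1; set e' := (_ ^+ _ ^+ _)^-1; lra.
have [k Ak [D kD]] := cA x 2 Ax fast.
exists k => //; apply: min_dist_orthogonal => // k' Ak'.
rewrite (le_trans _ (dle _ Ak'))// -subr_le0.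
apply: (@geometric_le0 (1 + 2 * Num.sqrt (`|d| + 1) * `|D| + D ^+ 2)) => n.
have -> : h - k = (h - x n) + (x n - k) by rewrite subrKA.
set s := h - x n; set t := x n - k.
have hs : B s s <= d + (2 ^+ n ^+ 2)^-1 by exact: xd.
have en1 : (2 ^+ n : R)^-1 <= 1.
  by rewrite invf_le1 ?exprn_gt0// exprn_ege1// ler1n.
have en0 : 0 < (2 ^+ n : R)^-1 by rewrite invr_gt0 exprn_gt0.
have en2 : (2 ^+ n ^+ 2 : R)^-1 <= (2 ^+ n)^-1.
  by rewrite -(exprVn (2 ^+ n)) expr2 ler_piMl// ltW.
have ht : snorm t <= `|D| / 2 ^+ n.
  by rewrite (le_trans (kD n))// ler_pM2r// ler_norm.
have hsn : snorm s <= Num.sqrt (`|d| + 1).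
  rewrite ler_wsqrtr// (le_trans hs)// lerD ?ler_norm// (le_trans en2)//.
have htt : B t t <= D ^+ 2 / 2 ^+ n.
  rewrite -snorm_sqr (le_trans (_ : _ <= (`|D| / 2 ^+ n) ^+ 2))//.
    by rewrite ler_pXn2r// nnegrE ?snorm_ge0// mulr_ge0// ltW.
  rewrite expr_div_n real_normK ?num_real// ler_wpM2l ?sqr_ge0//.
have hst : B s t <= Num.sqrt (`|d| + 1) * `|D| / 2 ^+ n.
  rewrite (le_trans (ler_norm _))// (le_trans (form_le_snorm _ _))//.
  by rewrite -mulrA ler_pM ?snorm_ge0.
rewrite (form_sqrD s t).
rewrite !mulrDl mul1r -!mulrA in hst *.
lra.
Qed.

End subspace_theory.

(** The sum of two complete subspaces making a positive angle is complete: the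
    angle hypothesis bounds the increments of the first components by those of
    the sums, so both components of a fast sequence are fast. *)
Lemma scomplete_add A C (c : R) : lin_subspace A -> lin_subspace C ->
  scomplete A -> scomplete C -> 0 < c ->
  (forall a b, A a -> C b -> c * B a a <= B (a + b) (a + b)) ->
  scomplete [set z | exists2 a, A a & exists2 b, C b & z = a + b].
Proof.
move=> sA sC cA cC c0 angle x K xAC fast.
have aP n : {a | A a & exists2 b, C b & x n = a + b}.
  by apply: cid2; have [a Aa [b Cb ->]] := xAC n; exists a => //; exists b.
pose a n := s2val (aP n).
have bP n : {b | C b & x n = a n + b} by apply: cid2; exact: (s2valP' (aP n)).
pose b n := s2val (bP n).
have Aa n : A (a n) by exact: (s2valP (aP n)).
have Cb n : C (b n) by exact: (s2valP (bP n)).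
have xab n : x n = a n + b n by exact: (s2valP' (bP n)).
pose s := (Num.sqrt c)^-1.
have s0 : 0 < s by rewrite invr_gt0 sqrtr_gt0.
have anorm y z : A y -> C z -> snorm y <= s * snorm (y + z).
  move=> Ay Cz; rewrite mulrC ler_pdivlMr ?sqrtr_gt0// mulrC.
  by rewrite /snorm -sqrtrM ?(ltW c0)// ler_wsqrtr// angle.
have dx n : x n.+1 - x n = (a n.+1 - a n) + (b n.+1 - b n).
  by rewrite !xab opprD addrACA.
have afast n : snorm (a n.+1 - a n) <= (s * K) / 2 ^+ n.
  rewrite (le_trans (anorm _ (b n.+1 - b n) _ _)) -?dx -?mulrA ?ler_pM2l//;
  exact: subspaceB.
have bfast n : snorm (b n.+1 - b n) <= (s * K + K) / 2 ^+ n.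
  have -> : b n.+1 - b n = - (a n.+1 - a n) + (x n.+1 - x n).
    by rewrite dx addKr.
  by rewrite mulrDl (le_trans (ler_snormD _ _))// snormN lerD.
have [a' Aa' [Da aD]] := cA a _ Aa afast.
have [b' Cb' [Db bD]] := cC b _ Cb bfast.
exists (a' + b'); first by exists a' => //; exists b'.
exists (Da + Db) => n; rewrite xab opprD addrACA mulrDl.
by rewrite (le_trans (ler_snormD _ _))// lerD.
Qed.

Lemma scomplete_orthogonal A (Q : set V) : scomplete A ->
  scomplete [set h | A h /\ forall k, Q k -> B h k = 0].
Proof.
move=> cA x K xA fast.
have [y Ay [D yD]] := cA x K (fun n => (xA n).1) fast.
exists y; last by exists D.
split => // k Qk; apply/eqP; rewrite -normr_le0.
apply: (@geometric_le0 (D * snorm k)) => n.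
have -> : B y k = B (y - x n) k.
  by rewrite formDl formNl (xA n).2// subr0.
rewrite (le_trans (form_le_snorm _ _))// snormB mulrAC.
by rewrite ler_wpM2r ?snorm_ge0.
Qed.

Lemma lin_subspace_orthogonal A (Q : set V) : lin_subspace A ->
  lin_subspace [set h | A h /\ forall k, Q k -> B h k = 0].
Proof.
move=> sA; split; first by split=> [|k _]; [exact: sA.1|exact: form0l].
move=> a x y [Ax xQ] [Ay yQ]; split; first exact: sA.2.
by move=> k Qk; rewrite formDl formZl xQ// yQ// mulr0 addr0.
Qed.

End semi_inner_theory.

(** * Hierarchical decomposition for a family of subspaces *)

Section hoeffding.
Context (R : realType) (V : lmodType R) (B : semi_inner V) (I : finType).
Context (H H0 : {set I} -> set V) (c : R).

(** A vector a of H u that is orthogonal to the smaller spaces stays at distance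
    at least sqrt c * |a| from the sum of all the spaces H v with u not included
    in v. The orthogonality already covers v strictly included in u; the content
    is in the spaces H v that are not comparable with H u. *)
Definition wide_angle :=
  forall (u : {set I}) (a : V) (b : {set I} -> V), H u a ->
  (forall v : {set I}, v \proper u -> forall k, H v k -> B a k = 0) ->
  (forall v : {set I}, ~~ (u \subset v) -> H v (b v)) ->
  c * B a a <= B (a + \sum_(v : {set I} | ~~ (u \subset v)) b v)
                 (a + \sum_(v : {set I} | ~~ (u \subset v)) b v).

Context (H_subspace : forall u, lin_subspace (H u))
  (H_complete : forall u, scomplete B (H u))
  (H_mono : forall u v : {set I}, u \subset v -> H u `<=` H v)
  (H0E : forall u, H0 u = [set h | H u h /\
     forall v : {set I}, v \proper u -> forall k, H0 v k -> B h k = 0])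
  (c_gt0 : 0 < c) (angle : wide_angle).

Definition direct_sum (S : {set {set I}}) : set V :=
  [set x | exists2 a : {set I} -> V,
    (forall v : {set I}, v \in S -> H0 v (a v)) & x = \sum_(v in S) a v].

Let down (u : {set I}) : {set {set I}} := [set v : {set I} | v \subset u].
Let sdown (u : {set I}) : {set {set I}} := [set v : {set I} | v \proper u].

Lemma H0_orth u : H0 u =
  [set h | H u h /\
   forall k, (exists2 v : {set I}, v \proper u & H0 v k) -> B h k = 0].
Proof.
rewrite {1}H0E; apply/seteqP; split => h /= [Hh hO]; split => //.
  by move=> k [v vu]; exact: hO.
by move=> v vu k Hk; apply: hO; exists v.
Qed.

Lemma H0_subspace u : lin_subspace (H0 u).
Proof. by rewrite H0_orth; exact: lin_subspace_orthogonal. Qed.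

Lemma H0_complete u : scomplete B (H0 u).
Proof. by rewrite H0_orth; exact: scomplete_orthogonal. Qed.

Lemma H0_sub u : H0 u `<=` H u.
Proof. by rewrite H0E => h []. Qed.

(** H0 u is defined to be orthogonal to H0 v only; orthogonality to the whole of
    H v follows once H v is known to split into the H0 w, for w included
    in v. *)
Lemma H0_orthogonal (u : {set I}) :
  (forall v : {set I}, v \proper u -> H v `<=` direct_sum (down v)) ->
  forall a, H0 u a -> forall v : {set I}, v \proper u ->
  forall k, H v k -> B a k = 0.
Proof.
move=> dec a; rewrite H0E => -[_ aO] v vu k /(dec v vu)[b Hb ->].
rewrite form_sumr big1// => w; rewrite inE => wv.
by apply: (aO w); [exact: sub_proper_trans wv vu|apply: Hb; rewrite inE].
Qed.

Lemma direct_sum_subspace S : lin_subspace (direct_sum S).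
Proof.
split.
  exists (fun=> 0); first by move=> v _; exact: (H0_subspace v).1.
  by rewrite big1.
move=> t x y [a aH ->] [b bH ->]; exists (fun v => t *: a v + b v).
  by move=> v vS; apply: (H0_subspace v).2; [exact: aH|exact: bH].
by rewrite big_split/= scaler_sumr.
Qed.

(** Split off from S an element u of maximal cardinality: it is included in no
    other member of S, so the angle hypothesis compares H0 u with the sum of the
    other spaces, which is complete by induction. *)
Lemma direct_sum_complete (S : {set {set I}}) :
  (forall u : {set I}, u \in S ->
   forall v : {set I}, v \proper u -> H v `<=` direct_sum (down v)) ->
  scomplete B (direct_sum S).
Proof.
have [n] := ubnP #|S|; elim: n S => // n IHn S Sn dec.
have [->|[u0 u0S]] := set_0Vmem S.
  move=> x K x0 _; exists 0.
    by exists (fun=> 0) => [v|]; [rewrite inE|rewrite big_set0].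
  exists 0 => k; have [a _ ->] := x0 k.
  by rewrite big_set0 subrr snorm0 mul0r.
have [u uS umax] := @arg_maxnP _ u0 (mem S) (fun v : {set I} => #|v|) u0S.
have {}uS : u \in S := uS.
have -> : direct_sum S = [set z | exists2 a, H0 u a &
    exists2 b, direct_sum (S :\ u) b & z = a + b].
  apply/seteqP; split => [_ [a aH ->]|_ [a Ha [_ [b bH ->] ->]]] /=.
    exists (a u); first exact: aH.
    exists (\sum_(v in S :\ u) a v); last by rewrite (big_setD1 u).
    by exists a => // v; rewrite !inE => /andP[_]; exact: aH.
  exists (fun v => if v == u then a else b v).
    move=> v vS; case: eqVneq => [->//|vu].
    by apply: bH; rewrite !inE vu.
  rewrite [RHS](big_setD1 u)//= eqxx; congr (_ + _).
  by apply: eq_bigr => v; rewrite !inE => /andP[/negPf-> _].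
apply: (scomplete_add (c := c)) => //.
- exact: H0_subspace.
- exact: direct_sum_subspace.
- exact: H0_complete.
- apply: IHn.
    by rewrite (cardsD1 u S) uS in Sn.
  by move=> v; rewrite !inE => /andP[_]; exact: dec.
move=> a _ Ha [b bH ->].
have := @angle u a (fun v => if v \in S :\ u then b v else 0) (H0_sub Ha).
rewrite /= -big_mkcondr/=.
rewrite (eq_bigl (mem (S :\ u))).
  apply; first exact: (H0_orthogonal (dec u uS)).
  move=> v _; case: ifP => [/bH/H0_sub//|_]; exact: (H_subspace v).1.
move=> v; rewrite /= andbC; case: (boolP (v \in S :\ u)) => //=.
rewrite !inE => /andP[vu vS]; apply/negP => uv.
have : (#|v| <= #|u|)%N := umax v vS.
by rewrite leqNgt proper_card// finset.properEneq eq_sym vu uv.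
Qed.

(** By induction on u: the sum K of the H0 v, for v strictly included in u, is
    complete, and lies in H u by monotonicity. The component in H0 u of a vector
    of H u is its difference with its projection on K. *)
Lemma hoeffding_ex u : H u `<=` direct_sum (down u).
Proof.
have [n] := ubnP #|u|; elim: n u => // n IHn u un h Hh.
have dec (v : {set I}) : v \proper u -> H v `<=` direct_sum (down v).
  by move=> vu; apply: IHn; rewrite -ltnS (leq_trans _ un)// ltnS proper_card.
have cK : scomplete B (direct_sum (sdown u)).
  apply: direct_sum_complete => v; rewrite inE => vu w wv.
  by apply: dec; exact: proper_trans wv vu.
have [_ [a aH ->] hO] := scomplete_projection (direct_sum_subspace _) h cK.
set k := \sum_(_ in _) _ in hO.
have Hk : H u k.
  apply: subspace_sum => // v; rewrite inE => vu.
  apply: (H_mono (proper_sub vu)); apply/H0_sub/aH; by rewrite inE.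
exists (fun v => if v == u then h - k else a v).
  move=> v; rewrite inE => vu; case: eqVneq => [->|vNu].
    rewrite H0E; split; first exact: subspaceB.
    move=> w wu x Hx; apply: hO; exists (fun v' => if v' == w then x else 0).
      move=> v' _; case: eqVneq => [->//|_]; exact: (H0_subspace v').1.
    rewrite (bigD1 w) ?inE//= eqxx big1 ?addr0// => v' /andP[_ /negPf->//].
  by apply: aH; rewrite inE finset.properEneq vNu.
rewrite (bigD1 u) ?inE//= eqxx addrC.
rewrite (eq_bigl (mem (sdown u))); last first.
  by move=> v; rewrite !inE finset.properEneq andbC.
rewrite (eq_bigr a); first by rewrite -/k subrKC.
move=> v vS; have vu : v \proper u by have : v \in sdown u := vS; rewrite inE.
case: eqVneq => [vuE|//]; by rewrite vuE fintype.properxx in vu.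
Qed.

(** By induction on u, from the full set downwards: the a v with u strictly
    included in v are null, so the sum s of the remaining components is null
    too, and the angle hypothesis gives c * B (a u) (a u) <= B s s = 0. *)
Lemma hoeffding_unique (a : {set I} -> V) : (forall u, H0 u (a u)) ->
  B (\sum_u a u) (\sum_u a u) = 0 -> forall u, B (a u) (a u) = 0.
Proof.
move=> aH s0.
suff main n (u : {set I}) : (#|I| - #|u| < n)%N -> B (a u) (a u) = 0.
  by move=> u; exact: (main _ u (ltnSn _)).
elim: n u => // n IHn u un.
have big0 (v : {set I}) : (#|u| < #|v|)%N -> B (a v) (a v) = 0.
  move=> uv; apply: IHn; have vI : (#|v| <= #|I|)%N := max_card _.
  by move: #|I| #|u| #|v| un uv vI => i j k; lia.
pose r := \sum_(v : {set I} | (u \subset v) && (v != u)) a v.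
have r0 : B r r = 0.
  rewrite /r; apply: (big_ind (fun x => B x x = 0)); first exact: form0l.
    by move=> x y x0 y0; rewrite form_sqrD x0 y0 form_null_l// mulr0 !addr0.
  move=> v /andP[uv vu]; apply: big0.
  by rewrite proper_card// finset.properEneq eq_sym vu.
have sum_split :
    \sum_v a v = a u + \sum_(v : {set I} | ~~ (u \subset v)) a v + r.
  rewrite (bigID (fun v : {set I} => u \subset v))/= (bigD1 u)//=.
  by rewrite -addrA (addrC r) addrA.
apply/eqP; rewrite eq_le form_ge0 andbT -(pmulr_rle0 _ c_gt0).
have orth (v : {set I}) : v \proper u -> forall k, H v k -> B (a u) k = 0.
  by apply: H0_orthogonal => // w _; exact: hoeffding_ex.
apply: le_trans (angle (H0_sub (aH u)) orth (fun v _ => H0_sub (aH v))) _.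
move: s0; rewrite sum_split form_sqrD r0 addr0.
by rewrite (formC B _ r) (form_null_l _ r0) mulr0 addr0 => ->.
Qed.

End hoeffding.

(** * The space of square integrable functions *)

Section L2.
Context d (T : measurableType d) (R : realType).
Context (mu : {measure set T -> \bar R}).

Definition L2 := LfunType mu (lee1n 2).

HB.instance Definition _ := GRing.Lmodule.on L2.

Implicit Types f g : L2.

Lemma L2_measurable f : measurable_fun setT (f : T -> R).
Proof. exact: measurable_funPT. Qed.

Lemma L2_memP (f : T -> R) : f \in Lfun mu 2%:E <->
  measurable_fun setT f /\ (\int[mu]_x (f x ^+ 2)%:E < +oo)%E.
Proof.
have intE : (\int[mu]_x (`|f x| `^ 2)%:E = \int[mu]_x (f x ^+ 2)%:E)%E.
  by apply: eq_integral => x _; rewrite powR_mulrn// real_normK// num_real.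
rewrite inE /=; split.
  move=> /andP[/[!inE]/= mf]; rewrite /finite_norm => fL; split => //.
  by move: fL => /(poweR_lty 2); rewrite powR_Lnorm//= intE.
move=> [mf fL]; apply/andP; split; rewrite inE//= /finite_norm unlock.
by rewrite /= poweR_lty// intE.
Qed.

Lemma L2_lift (f : T -> R) : f \in Lfun mu 2%:E -> {g : L2 | g = f :> (T -> R)}.
Proof. by move=> fL; exists (Lfun_Sub (lee1n 2) fL). Qed.

Lemma L2D f g t : (f + g : L2) t = f t + g t. Proof. by []. Qed.
Lemma L2N f t : (- f : L2) t = - f t. Proof. by []. Qed.
Lemma L2Z a f t : (a *: f : L2) t = a * f t. Proof. by []. Qed.
Lemma L20 t : (0 : L2) t = 0. Proof. by []. Qed.

Lemma L2_sum (I : finType) (Q : pred I) (a : I -> L2) t :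
  (\sum_(i | Q i) a i) t = \sum_(i | Q i) a i t.
Proof. by elim/big_rec2: _ => // i x y _ <-; rewrite L2D. Qed.

Lemma L2_integrableM f g : mu.-integrable setT (fun t => (f t * g t)%:E).
Proof. by apply/Lfun1_integrable; apply: Lfun2_mul_Lfun1; exact: LfunP. Qed.

Definition L2_form f g : R := \int[mu]_t (f t * g t).

Lemma L2_formE f g : (L2_form f g)%:E = (\int[mu]_t (f t * g t)%:E)%E.
Proof.
by rewrite fineK//; apply: integrable_fin_num => //; exact: L2_integrableM.
Qed.

Let L2_formC f g : L2_form f g = L2_form g f.
Proof. by apply: eq_Rintegral => t _; rewrite mulrC. Qed.

Let L2_formDl f g h : L2_form (f + g) h = L2_form f h + L2_form g h.
Proof.
rewrite /L2_form -RintegralD//; try exact: L2_integrableM.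
by apply: eq_Rintegral => t _; rewrite L2D mulrDl.
Qed.

Let L2_formZl a f g : L2_form (a *: f) g = a * L2_form f g.
Proof.
rewrite /L2_form -RintegralZl//; last exact: L2_integrableM.
by apply: eq_Rintegral => t _; rewrite L2Z mulrA.
Qed.

Let L2_form_ge0 f : 0 <= L2_form f f.
Proof. by apply: Rintegral_ge0 => t _; rewrite -expr2 sqr_ge0. Qed.

Definition L2_inner : semi_inner L2 :=
  SemiInner L2_formC L2_formDl L2_formZl L2_form_ge0.

Lemma L2_innerE f g : (L2_inner f g)%:E = (\int[mu]_t (f t * g t)%:E)%E.
Proof. exact: L2_formE. Qed.

Lemma L2_inner_sqr f : (L2_inner f f)%:E = (\int[mu]_t (f t ^+ 2)%:E)%E.
Proof. by rewrite L2_innerE; apply: eq_integral => t _; rewrite expr2. Qed.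

Lemma L2_inner_eq0 f : L2_inner f f = 0 <-> {ae mu, forall t, f t = 0}.
Proof.
have mf2 : measurable_fun [set: T] (EFin \o (fun t => f t ^+ 2)).
  by apply/measurable_EFinP; apply: measurable_funX; exact: L2_measurable.
have := @ae_eq_integral_abs _ _ _ mu setT measurableT _ mf2.
under eq_integral do rewrite gee0_abs ?lee_fin ?sqr_ge0//.
rewrite -L2_inner_sqr => -[i0 a0]; split => [f0|f0].
  have := i0 (congr1 EFin f0); apply: filterS => t /(_ I)[] /eqP.
  by rewrite sqrf_eq0 => /eqP.
apply: EFin_inj; apply: a0; apply: filterS f0 => t ft0 _ /=.
by rewrite ft0 expr0n.
Qed.

End L2.

(** * Completeness of L2 of a probability *)

Section L2_complete.
Context d (T : measurableType d) (R : realType) (mu : probability T R).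
Local Notation L2 := (L2 mu).
Local Notation B := (L2_inner mu).

(** Everywhere defined and measurable, and determined at each t by the values
    x n t: the last point lets a limit depend only on those coordinates on which
    all the x n depend. *)
Definition seq_limit (x : nat -> T -> R) (t : T) : R :=
  fine (limn_esup (fun n => (x n t)%:E)).

Lemma seq_limitE (x : nat -> T -> R) t l : x ^~ t @ \oo --> l ->
  seq_limit x t = l.
Proof.
move=> xl; have /cvg_limn_einf_sup[_ E] : (x n t)%:E @[n --> \oo] --> l%:E.
  by apply: cvg_EFin => //; exact: nearW.
by rewrite /seq_limit E.
Qed.

Lemma measurable_seq_limit (x : nat -> T -> R) :
  (forall n, measurable_fun setT (x n)) -> measurable_fun setT (seq_limit x).
Proof.
move=> mx; apply: measurableT_comp => //.
by apply: measurable_fun_limn_esup => n; exact/measurable_EFinP.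
Qed.


(** Integrate `|f t| <= e / 2 + f t ^+ 2 / (2 * e); the total mass is 1. *)
Lemma L2_norm_integral (f : L2) (e : R) : 0 < e -> snorm B f <= e ->
  (\int[mu]_t `|f t|%:E <= e%:E)%E.
Proof.
move=> e0 fe.
have mf := L2_measurable f.
have mf2 : measurable_fun [set: T] (EFin \o (fun t => (2 * e)^-1 * f t ^+ 2)).
  apply/measurable_EFinP; apply: measurable_funM => //.
  exact: measurable_funX.
have c0 : 0 <= (2 * e)^-1 by rewrite invr_ge0 mulr_ge0// ltW.
apply: (@le_trans _ _ (\int[mu]_t ((e / 2)%:E + ((2 * e)^-1 * f t ^+ 2)%:E))%E).
  apply: ge0_le_integral => //.
  - by apply/measurable_EFinP; exact: measurableT_comp.
  - by apply: emeasurable_funD.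
  - move=> t _; rewrite -EFinD lee_fin -subr_ge0.
    rewrite (_ : _ - _ = (e - `|f t|) ^+ 2 / (2 * e)).
      by rewrite divr_ge0 ?sqr_ge0// mulr_ge0// ltW.
    by rewrite -(real_normK (num_real (f t))); field; rewrite gt_eqF.
rewrite ge0_integralD//; last 2 first.
- by move=> t _; rewrite lee_fin divr_ge0// ltW.
- by move=> t _; rewrite lee_fin mulr_ge0// sqr_ge0.
rewrite integral_cst// [X in (_ * X)%E](@probability_setT _ _ _ mu) mule1.
under eq_integral do rewrite EFinM.
rewrite ge0_integralZl//; last 2 first.
- by apply/measurable_EFinP; exact: measurable_funX.
- by move=> t _; rewrite lee_fin sqr_ge0.
rewrite -L2_inner_sqr -EFinM -EFinD lee_fin -snorm_sqr.
rewrite (@le_trans _ _ (e / 2 + (2 * e)^-1 * e ^+ 2))//.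
  by rewrite lerD2l ler_wpM2l// ler_pXn2r// nnegrE ?snorm_ge0// ltW.
by rewrite (_ : _ + _ = e)//; field; rewrite gt_eqF.
Qed.

(** The integral of the series of the `|x n.+1 t - x n t| is bounded by a
    geometric series, so for almost all t this series is finite. *)
Lemma fast_ae_cvg (x : nat -> L2) (C : R) :
  (forall n, snorm B (x n.+1 - x n) <= C / 2 ^+ n) ->
  {ae mu, forall t, x ^~ t @ \oo --> seq_limit x t}.
Proof.
move=> fast.
(* The 1 makes the bounds positive, the factor 2 adjusts C / 2 ^ n to the
   terms K / 2 ^ n.+1 of the summable series used below. *)
pose K := 2 * (`|C| + 1).
have K0 : 0 < K by rewrite mulr_gt0// ltr_wpDl.
pose S t := (\sum_(n <oo) `|x n.+1 t - x n t|%:E)%E.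
have mx n : measurable_fun [set: T] (EFin \o (fun t => `|x n.+1 t - x n t|)).
  apply/measurable_EFinP; apply: measurableT_comp => //.
  by apply: measurable_funB; exact: L2_measurable.
have iS : (\int[mu]_t S t <= K%:E)%E.
  rewrite integral_nneseries//.
  apply: (le_trans _ (epsilon_trick0 xpredT (ltW K0))).
  apply: lee_nneseries => [n _ _|n _]; first exact: integral_ge0.
  apply: (@L2_norm_integral (x n.+1 - x n)); first by rewrite divr_gt0.
  rewrite (le_trans (fast n))// /K natrX exprS invfM mulrACA divff// mul1r.
  rewrite ler_pM2r ?invr_gt0 ?exprn_gt0//.
  by rewrite (le_trans (ler_norm _))// lerDl.
have S0 t : (0 <= S t)%E by exact: nneseries_ge0.
have mS : measurable_fun [set: T] S.
  by apply: ge0_emeasurable_sum => n *; [rewrite lee_fin|exact: mx].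
have Sint : mu.-integrable setT S.
  apply/integrableP; split => //; under eq_integral do rewrite gee0_abs//.
  by rewrite (le_lt_trans iS)// ltry.
apply: filterS (integrable_ae measurableT Sint) => t /(_ I) Sfin.
have cx : cvgn (x ^~ t).
  have : cvgn (series (telescope (x ^~ t))).
    apply: normed_cvg; apply: nondecreasing_is_cvgn.
      by apply: nondecreasing_series => n _ _; rewrite normr_ge0.
    exists (fine (S t)) => _ [n _ <-].
    rewrite -lee_fin fineK// /normed_series_of seriesEnat/= -sumEFin.
    exact: (@nneseries_lim_ge _ (fun n => `|x n.+1 t - x n t|%:E) xpredT).
  rewrite telescopeK => cx0.
  have -> : x ^~ t = (fun n => (x n t - x 0 t) + x 0 t).
    by apply/funext => n; rewrite subrK.
  by apply: is_cvgD => //; exact: is_cvg_cst.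
by rewrite (seq_limitE cx).
Qed.

Lemma fast_dist (x : nat -> L2) (C : R) n k :
  (forall n, snorm B (x n.+1 - x n) <= C / 2 ^+ n) ->
  snorm B (x n - x (n + k)%N) <= (C * 2) / 2 ^+ n.
Proof.
move=> fast.
have C0 : 0 <= C by have := le_trans (snorm_ge0 _ _) (fast 0%N); rewrite divr1.
suff : snorm B (x n - x (n + k)%N) <= (C * 2) / 2 ^+ n - (C * 2) / 2 ^+ (n + k).
  by move=> /le_trans; apply; rewrite gerBl divr_ge0 ?mulr_ge0 ?exprn_ge0.
elim: k => [|k IHk]; first by rewrite addn0 !subrr snorm0.
rewrite (le_trans (ler_snorm_dist _ _ (x (n + k)%N) _))//.
rewrite (le_trans (lerD IHk (_ : _ <= C / 2 ^+ (n + k))))//.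
  by rewrite snormB addnS.
rewrite addnS exprS le_eqVlt; apply/orP; left; apply/eqP; field.
by rewrite !expf_neq0.
Qed.

(** The pointwise limit is also the limit in L2: apply Fatou's lemma to the
    functions (x n - x (n + k)) ^+ 2 as k grows. *)
Lemma L2_fast_limit (x : nat -> L2) (C : R) :
  (forall n, snorm B (x n.+1 - x n) <= C / 2 ^+ n) ->
  exists2 y : L2, y = seq_limit x :> (T -> R) &
    forall n, snorm B (x n - y) <= (C * 2) / 2 ^+ n.
Proof.
move=> fast.
have C0 : 0 <= C by have := le_trans (snorm_ge0 _ _) (fast 0%N); rewrite divr1.
have cx := fast_ae_cvg fast.
pose l := seq_limit x.
have ml : measurable_fun setT l.
  by apply: measurable_seq_limit => n; exact: L2_measurable.
have mD n (f : T -> R) : measurable_fun setT f ->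
    measurable_fun [set: T] (EFin \o (fun t => (x n t - f t) ^+ 2)).
  move=> mf; apply/measurable_EFinP; apply: measurable_funX.
  by apply: measurable_funB => //; exact: L2_measurable.
have bound n : (\int[mu]_t ((x n t - l t) ^+ 2)%:E <=
    ((C * 2 / 2 ^+ n) ^+ 2)%:E)%E.
  pose F k t := ((x n t - x (n + k)%N t) ^+ 2)%:E : \bar R.
  have mF k : measurable_fun setT (F k) by apply: mD; exact: L2_measurable.
  have F0 k t : (0 <= F k t)%E by rewrite lee_fin sqr_ge0.
  rewrite (_ : integral _ _ _ = \int[mu]_t limn_einf (F ^~ t))%E; last first.
    apply: ge0_ae_eq_integral => //.
    - exact: mD.
    - rewrite (_ : (fun _ => _) =
          -%E \o (fun t => limn_esup (fun k => - F k t))%E)//.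
      apply: measurableT_comp => //; apply: measurable_fun_limn_esup => k.
      exact: measurableT_comp.
    - by move=> t _; rewrite lee_fin sqr_ge0.
    - move=> t _; rewrite limn_einf_lim; apply: lime_ge.
        exact: is_cvg_einfs.
      by apply: nearW => k; apply/ereal_infP => _ [j _ <-].
    - apply: filterS cx => t xl _.
      have /cvg_limn_einf_sup[-> //] :
          F k t @[k --> \oo] --> ((x n t - l t) ^+ 2)%:E.
      apply: cvg_EFin; first exact: nearW.
      have xnk : x (n + k)%N t @[k --> \oo] --> l t.
        rewrite (_ : (fun k => _) = (fun k => x (k + n)%N t)).
          by move: xl; rewrite -(cvg_shiftn n).
        by apply/funext => k; rewrite addnC.
      have c : x n t - x (n + k)%N t @[k --> \oo] --> x n t - l t.
        by apply: cvgB => //; exact: cvg_cst.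
      exact: (cvgM c c).
  apply: le_trans (fatou _ _ _ _) _ => //.
  rewrite limn_einf_lim; apply: lime_le; first exact: is_cvg_einfs.
  apply: nearW => k; apply: (@le_trans _ _ (\int[mu]_t F k t)%E).
    by apply: ereal_inf_lbound; exists k => /=.
  rewrite (_ : integral _ _ _ = (B (x n - x (n + k)%N) (x n - x (n + k)%N))%:E).
    rewrite lee_fin -snorm_sqr ler_pXn2r ?nnegrE ?snorm_ge0 ?fast_dist//.
    by rewrite divr_ge0 ?mulr_ge0 ?exprn_ge0.
  by rewrite L2_inner_sqr; apply: eq_integral.
have lL2 : l \in Lfun mu 2%:E.
  have dL : (fun t => x 0%N t - l t) \in Lfun mu 2%:E.
    apply/L2_memP; split; last by rewrite (le_lt_trans (bound 0%N))// ltry.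
    by apply: measurable_funB => //; exact: L2_measurable.
  have [e eE] := L2_lift dL.
  rewrite (_ : l = (x 0%N - e : L2)); first exact: LfunP.
  by apply/funext => t; rewrite L2D L2N eE opprB subrKC.
have [y yl] := L2_lift lL2; exists y => // n.
rewrite -(ler_pXn2r (n := 2)) ?nnegrE ?snorm_ge0//; last first.
  by rewrite divr_ge0 ?mulr_ge0 ?exprn_ge0.
rewrite snorm_sqr -lee_fin L2_inner_sqr (le_trans _ (bound n))//.
by rewrite le_eqVlt; apply/orP; left; apply/eqP/eq_integral => t _; rewrite -yl.
Qed.

End L2_complete.

(** * Splitting a product measure along a set of coordinates *)

Section boxes.
Context d (T : measurableType d) (n : nat).

Definition measurable_boxes : set (set (n.-tuple T)) :=
  [set box A | A in [set A : 'I_n -> set T | forall i, measurable (A i)]].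

Lemma boxes_setI_closed : setI_closed measurable_boxes.
Proof.
move=> _ _ [A mA <-] [B mB <-].
exists (fun i => A i `&` B i); first by move=> i; exact: measurableI.
apply/seteqP; split => t /=; first by move=> AB; split => i; have [] := AB i.
by move=> [tA tB] i; split; [exact: tA|exact: tB].
Qed.

Lemma measurable_tupleE :
  @measurable _ (n.-tuple T) = <<s measurable_boxes >>.
Proof.
apply/seteqP; split; last first.
  apply: smallest_sub; first exact: sigma_algebra_measurable.
  by move=> _ [A mA <-]; exact: measurable_box.
pose U := g_sigma_algebraType measurable_boxes.
have mid : measurable_fun [set: U] (id : U -> n.-tuple T).
  apply/measurable_fun_tnthP => i _ B mB; rewrite setTI.
  apply: sub_sigma_algebra.
  exists (fun j => if j == i then B else setT).
    by move=> j; case: ifP.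
  apply/seteqP; split => t /=; first by move=> /(_ i); rewrite eqxx.
  by move=> tB j; case: eqVneq => [->|].
by move=> A mA; have := mid measurableT A mA; rewrite setTI.
Qed.

(** Boxes are stable under intersection and generate the sigma-algebra, and each
    factor is exhausted by sets of finite measure. *)
Lemma tprod_unique (R : realType)
    (m : 'I_n -> {sigma_finite_measure set T -> \bar R})
    (mu : {measure set (n.-tuple T) -> \bar R}) :
  (forall A : 'I_n -> set T, (forall i, measurable (A i)) ->
    mu (box A) = (\prod_(i < n) m i (A i))%E) ->
  forall A, measurable A -> tprod m A = mu A.
Proof.
move=> muE A mA.
have F i : {F : (set T)^nat | [/\ setT = \bigcup_k F k, nondecreasing_seq F &
    forall k, measurable (F k) /\ (m i (F k) < +oo)%E]}.
  apply: cid; have /sigma_finiteP[F [FT ndF mF]] := sigma_finiteT (m i).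
  by exists F.
have mF i k : measurable (sval (F i) k).
  by case: (svalP (F i)) => _ _ /(_ k)[].
apply: (measure_unique measurable_boxes
  (fun k => box (fun i => sval (F i) k))) => //.
- exact: measurable_tupleE.
- exact: boxes_setI_closed.
- by move=> k; exists (fun i => sval (F i) k).
- rewrite -subTset => t _.
  have kP i : {k | sval (F i) k (tnth t i)}.
    apply: cid; case: (svalP (F i)) => FT _ _.
    have : [set: T] (tnth t i) by [].
    by rewrite {1}FT => -[k _ ?]; exists k.
  exists (\max_(i < n) sval (kP i))%N => // i.
  case: (svalP (F i)) => _ ndF _.
  have /ndF/subsetPset := @leq_bigmax 'I_n (fun i => sval (kP i)) i.
  by apply; exact: svalP (kP i).
- by move=> _ [B mB <-]; rewrite [LHS]tprod_box// muE.
- move=> k; rewrite [X in (X < _)%E]tprod_box// ltey_eq; apply/orP; left.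
  apply: (big_ind (fun x => x \is a fin_num)) => //.
    by move=> x y; exact: fin_numM.
  move=> i _; rewrite ge0_fin_numE ?measure_ge0//.
  by case: (svalP (F i)) => _ _ /(_ k)[].
Qed.

End boxes.

Section join.
Context (R : realType) (p : nat).
Implicit Types (u : {set 'I_p}) (x : p.-tuple R).

(** The coordinate of index i in the numbering of the full vector; the default
    value 0 is returned when i is not in u. *)
Definition coord u (y : #|u|.-tuple R) (i : 'I_p) : R :=
  nth 0 y (index i (enum u)).

Lemma coord_enum_val u (y : #|u|.-tuple R) j : coord y (enum_val j) = tnth y j.
Proof.
rewrite /coord (tnth_nth 0); congr nth.
by rewrite /enum_val index_uniq ?enum_uniq// -cardE.
Qed.

Lemma coord_in u (i : 'I_p) : i \in u -> {j : 'I_#|u| | i = enum_val j}.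
Proof. by move=> iu; exists (enum_rank_in iu i); rewrite enum_rankK_in. Qed.

Lemma coord_subvec u x i : i \in u -> coord (subvec u x) i = tnth x i.
Proof. by move=> /coord_in[j ->]; rewrite coord_enum_val tnth_mktuple. Qed.

Lemma measurable_coord u i :
  measurable_fun setT (fun y : #|u|.-tuple R => coord y i).
Proof.
have [/coord_in[j ->]|iNu] := boolP (i \in u).
  under eq_fun do rewrite coord_enum_val; exact: measurable_tnth.
rewrite (_ : (fun _ => _) = cst 0)//; apply/funext => y /=.
by rewrite /coord nth_default// size_tuple cardE leqNgt index_mem mem_enum.
Qed.

Definition join u (yz : #|u|.-tuple R * #|~: u|.-tuple R) : p.-tuple R :=
  [tuple if i \in u then coord yz.1 i else coord yz.2 i | i < p].

Lemma measurable_join u : measurable_fun setT (@join u).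
Proof.
apply/measurable_fun_tnthP => i.
rewrite (_ : _ \o _ =
  fun yz => if i \in u then coord yz.1 i else coord yz.2 i); last first.
  by apply/funext => yz; rewrite /= tnth_mktuple.
case: (i \in u).
  exact: (measurableT_comp (measurable_coord i) measurable_fst).
exact: (measurableT_comp (measurable_coord i) measurable_snd).
Qed.

HB.instance Definition _ u :=
  isMeasurableFun.Build _ _ _ _ (@join u) (@measurable_join u).

Lemma subvec_join u yz : subvec u (@join u yz) = yz.1.
Proof.
apply/eq_from_tnth => j; rewrite tnth_mktuple tnth_mktuple.
by rewrite enum_valP coord_enum_val.
Qed.

Lemma subvec_joinC u yz : subvec (~: u) (@join u yz) = yz.2.
Proof.
apply/eq_from_tnth => j; rewrite tnth_mktuple tnth_mktuple.
by have := enum_valP j; rewrite finset.inE => /negPf ->; rewrite coord_enum_val.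
Qed.

(** The coupling device of the whole proof: under two independent copies x, x'
    of the vector, mix u x x' has the law of the product of its two marginals
    on u and ~: u. *)
Definition mix u x x' : p.-tuple R :=
  [tuple if i \in u then tnth x i else tnth x' i | i < p].

Lemma join_subvec u x x' : join (subvec u x, subvec (~: u) x') = mix u x x'.
Proof.
apply/eq_from_tnth => i; rewrite !tnth_mktuple.
case: (boolP (i \in u)) => iu; rewrite coord_subvec//.
by rewrite finset.inE.
Qed.

Lemma measurable_mix u : measurable_fun setT (fun xx => mix u xx.1 xx.2).
Proof.
under eq_fun do rewrite -join_subvec.
apply: (measurableT_comp (@measurable_join u)).
apply: measurable_fun_pair.
  exact: (measurableT_comp (@measurable_subvec _ _ _ u) measurable_fst).
exact: (measurableT_comp (@measurable_subvec _ _ _ (~: u)) measurable_snd).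
Qed.

Lemma measurable_mix_section d (S : measurableType d) u x'
    (F : p.-tuple R -> S) :
  measurable_fun setT F -> measurable_fun setT (fun x => F (mix u x x')).
Proof.
move=> mF; apply: (measurableT_comp mF).
exact: measurableT_comp (@measurable_mix u) (measurable_pair2 x').
Qed.

Lemma measurable_integral_mix (mu : {sigma_finite_measure set _ -> \bar R}) u
    (F : p.-tuple R -> \bar R) :
  measurable_fun setT F -> (forall x, 0 <= F x)%E ->
  measurable_fun setT (fun x' => \int[mu]_x F (mix u x x'))%E.
Proof.
move=> mF F0.
exact: (measurable_fun_fubini_tonelli_G (m1 := mu)
  (fun xx => F (mix u xx.1 xx.2))
  (measurableT_comp mF (@measurable_mix u)) (fun=> F0 _)).
Qed.

Section tprod_join.
Context (nu : 'I_p -> {sigma_finite_measure set R -> \bar R}).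

Local Notation subtprod u := (tprod (fun i : 'I_#|u| => nu (enum_val i))).

(** By uniqueness of the product measure on boxes: a box is the join of a box on
    u and a box on ~: u. *)
Lemma tprod_join u A : measurable A ->
  tprod nu A = pushforward (subtprod u \x subtprod (~: u))%E (@join u) A.
Proof.
move=> mA; apply: (@tprod_unique _ _ _ _ nu
  (pushforward (subtprod u \x subtprod (~: u))%E (@join u))) => // {mA}A mA.
have preE : @join u @^-1` box A = box (fun i : 'I_#|u| => A (enum_val i)) `*`
    box (fun i : 'I_#|~: u| => A (enum_val i)).
  apply/seteqP; split => yz /= => [yzA|[yA zA] i].
    split=> i.
      have := yzA (enum_val i).
      by rewrite tnth_mktuple enum_valP coord_enum_val.
    have := yzA (enum_val i); have := enum_valP i.
    by rewrite finset.inE tnth_mktuple => /negPf ->; rewrite coord_enum_val.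
  rewrite tnth_mktuple; case: (boolP (i \in u)) => [/coord_in|]; last first.
    by rewrite -finset.in_setC => /coord_in[j ->]; rewrite coord_enum_val.
  by move=> [j ->]; rewrite coord_enum_val.
rewrite [LHS](congr1 (subtprod u \x subtprod (~: u))%E preE).
rewrite product_measure1E; [|exact: measurable_box|exact: measurable_box].
rewrite [X in (X * _)%E]tprod_box// [X in (_ * X)%E]tprod_box//.
rewrite -!(big_enum_val (fun i => nu i (A i))).
rewrite [RHS](bigID (mem u))/=; congr (_ * _)%E.
by apply: eq_bigl => i; rewrite finset.inE.
Qed.

(** The preimage of a null set N of the subproduct is N times the whole space,
    which is null for the product even if the second factor is infinite. *)
Lemma ae_subvec u (Q : #|u|.-tuple R -> Prop) :
  {ae subtprod u, forall y, Q y} ->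
  {ae tprod nu, forall x, Q (subvec u x)}.
Proof.
move=> [N [mN N0 QN]]; exists (subvec u @^-1` N); split.
- by rewrite -[X in measurable X]setTI; exact: measurable_subvec.
- rewrite (@tprod_join u); last first.
    by rewrite -[X in measurable X]setTI; exact: measurable_subvec.
  have preE : @join u @^-1` (subvec u @^-1` N) = N `*` setT.
    by apply/seteqP; split => yz /=; rewrite subvec_join// => -[].
  rewrite [LHS](congr1 (subtprod u \x subtprod (~: u))%E preE).
  by rewrite product_measure1E// [X in (X * _)%E]N0 mul0e.
- by move=> x /= Qx; exact: QN.
Qed.

End tprod_join.
End join.

(** * The density bound as a comparison of measures *)

Section density_bound.
Context d (Omega : measurableType d) (R : realType) (P : probability Omega R).
Context (p : nat) (X : {RV P >-> p.-tuple R}).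
Context (nu : 'I_p -> {sigma_finite_measure set R -> \bar R}).
Context (PX_ll_nu : distribution P X `<< tprod nu).
Implicit Types u : {set 'I_p}.
Local Notation mu := (distribution P X).
Local Notation subtprod u := (tprod (fun i : 'I_#|u| => nu (enum_val i))).
Local Notation submu u := (distribution P (subvec u \o X)).

Lemma submu_dominated u : submu u `<< subtprod u.
Proof.
apply/null_content_dominatesP => A mA A0.
have mpre : measurable (subvec u @^-1` A).
  by rewrite -[X in measurable X]setTI; exact: measurable_subvec.
have /measure0_null_setP : tprod nu (subvec u @^-1` A) = 0%E.
  have : {ae subtprod u, forall y, ~ A y}.
    by exists A; split => // y /= /contrapT.
  move=> /ae_subvec[N [mN N0 AN]]; apply: (subset_measure0 _ mN _ N0) => //.
  by move=> x Ax; apply: AN => /=; apply.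
by move=> /(_ mpre)/PX_ll_nu/measure0_null_setP; apply.
Qed.

(** The law mu of the vector dominates M times the product of its two marginals.
    Write the right-hand side as the integral of F against the density, bound it
    below by M times the product of the marginal densities, split the reference
    measure along u, and recognize the two marginals by Tonelli. Stating the
    result with mix expresses both marginals through mu itself. *)
Lemma mix_integral_le u (M : R) (F : p.-tuple R -> \bar R) : 0 < M ->
  {ae tprod nu, forall x : p.-tuple R,
          (M%:E * (marginal_density X nu u (subvec u x) *
                   marginal_density X nu (~: u) (subvec (~: u) x))
           <= density P X (tprod nu) x)%E} ->
  measurable_fun setT F -> (forall x, 0 <= F x)%E ->
  (M%:E * \int[mu]_x' \int[mu]_x F (mix u x x') <= \int[mu]_x F x)%E.
Proof.
move=> M0 dens mF F0.
have dom1 := @submu_dominated u; have dom2 := @submu_dominated (~: u).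
(* These versions of the three densities agree a.e. with the given ones and are
   nonnegative everywhere, so that no integrability question arises below. *)
pose g1 := Radon_Nikodym_SigmaFinite.f (submu u) (subtprod u).
pose g2 := Radon_Nikodym_SigmaFinite.f (submu (~: u)) (subtprod (~: u)).
pose f0 := Radon_Nikodym_SigmaFinite.f mu (tprod nu).
have g1_ge0 y : (0 <= g1 y)%E by exact: Radon_Nikodym_SigmaFinite.f_ge0 dom1 y.
have g2_ge0 z : (0 <= g2 z)%E by exact: Radon_Nikodym_SigmaFinite.f_ge0 dom2 z.
have f0_ge0 x : (0 <= f0 x)%E.
  exact: Radon_Nikodym_SigmaFinite.f_ge0 PX_ll_nu x.
have mg1 : measurable_fun setT g1.
  exact: measurable_int (Radon_Nikodym_SigmaFinite.f_integrable dom1).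
have mg2 : measurable_fun setT g2.
  exact: measurable_int (Radon_Nikodym_SigmaFinite.f_integrable dom2).
have mf0 : measurable_fun setT f0.
  exact: measurable_int (Radon_Nikodym_SigmaFinite.f_integrable PX_ll_nu).
have fM : {ae tprod nu, forall x,
    (M%:E * (g1 (subvec u x) * g2 (subvec (~: u) x)) <= f0 x)%E}.
  have e0 := ae_eq_Radon_Nikodym_SigmaFinite PX_ll_nu measurableT.
  have e1 := ae_subvec (ae_eq_Radon_Nikodym_SigmaFinite dom1 measurableT).
  have e2 := ae_subvec (ae_eq_Radon_Nikodym_SigmaFinite dom2 measurableT).
  apply: filterS (filterI (filterI dens e0) (filterI e1 e2)) => x.
  move=> [[dx /(_ I) e0x] [/(_ I) e1x /(_ I) e2x]].
  by rewrite /g1 /g2 /f0 e0x e1x e2x.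
pose k yz := (F (@join R p u yz) * (M%:E * (g1 yz.1 * g2 yz.2)))%E.
have mjoin := @measurable_join R p u.
have mk : measurable_fun setT k.
  apply: emeasurable_funM; first exact: measurableT_comp mF mjoin.
  apply: emeasurable_funM => //; apply: emeasurable_funM.
    exact: (measurableT_comp mg1 measurable_fst).
  exact: (measurableT_comp mg2 measurable_snd).
have mH : measurable_fun setT (fun x =>
    F x * (M%:E * (g1 (subvec u x) * g2 (subvec (~: u) x))))%E.
  apply: emeasurable_funM => //; apply: emeasurable_funM => //.
  by apply: emeasurable_funM; apply: measurableT_comp => //;
    exact: measurable_subvec.
rewrite -(Radon_Nikodym_SigmaFinite.change_of_variables PX_ll_nu F0)//.
apply: (@le_trans _ _ (\int[tprod nu]_x
    (F x * (M%:E * (g1 (subvec u x) * g2 (subvec (~: u) x)))))%E); last first.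
  apply: ae_ge0_le_integral => //.
  - by move=> x _; rewrite !mule_ge0// lee_fin ltW.
  - by move=> x _; rewrite mule_ge0//; exact: f0_ge0.
  - by apply: emeasurable_funM.
  by apply: filterS fM => x fx _; rewrite lee_wpmul2l.
rewrite [X in (_ <= X)%E](eq_measure_integral
  (pushforward (subtprod u \x subtprod (~: u))%E (@join R p u))); last first.
  by move=> A mA _; exact: tprod_join.
rewrite [X in (_ <= X)%E]ge0_integral_pushforward//; last first.
  by move=> x _; rewrite /= !mule_ge0// lee_fin ltW.
rewrite [in X in (_ <= X)%E]preimage_setT.
under [X in (_ <= X)%E]eq_integral do rewrite /= subvec_join subvec_joinC.
rewrite (fubini_tonelli2 k)//; last first.
  by move=> yz; rewrite !mule_ge0// lee_fin ltW.
(* The density g1 is absorbed by the inner integral and g2 by the outer one. *)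
pose h z := (M%:E * \int[submu u]_y F (@join R p u (y, z)))%E.
have mFj : measurable_fun setT (F \o @join R p u) by exact: measurableT_comp.
have h_ge0 z : (0 <= h z)%E.
  by rewrite mule_ge0 ?lee_fin ?(ltW M0)//; apply: integral_ge0.
have mh : measurable_fun setT h.
  apply: emeasurable_funM => //.
  exact: (measurable_fun_fubini_tonelli_G (m1 := submu u) _ mFj (fun=> F0 _)).
have msec z : measurable_fun setT (fun y => F (@join R p u (y, z))).
  exact: measurableT_comp mFj (measurable_pair2 z).
rewrite [X in (_ <= X)%E](_ : _ =
    \int[subtprod (~: u)]_z (h z * g2 z))%E; last first.
  apply: eq_integral => z _; rewrite /fubini_G/=.
  rewrite (_ : (fun y => _) =
      (fun y => (M%:E * g2 z) * (F (@join R p u (y, z)) * g1 y)))%E; last first.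
    apply/funext => y; rewrite /k/=.
    by rewrite (muleC (g1 y)) !muleA (muleC (F _)) -!muleA (muleCA (F _)).
  rewrite ge0_integralZl//; last 3 first.
  - by apply: emeasurable_funM => //; exact: msec.
  - by move=> y _; rewrite mule_ge0.
  - by rewrite mule_ge0// lee_fin ltW.
  rewrite (Radon_Nikodym_SigmaFinite.change_of_variables dom1); last 3 first.
  - by [].
  - by [].
  - exact: msec.
  by rewrite /h muleAC.
rewrite /g2 [X in (_ <= X)%E]
  (Radon_Nikodym_SigmaFinite.change_of_variables dom2 h_ge0); last 2 first.
- by [].
- exact: mh.
have mhs : measurable_fun setT (h \o subvec (~: u)).
  exact: measurableT_comp mh (@measurable_subvec _ _ _ (~: u)).
have mmix x' := measurable_mix_section u x' mF.
have hE x' : h (subvec (~: u) x') = (M%:E * \int[mu]_x F (mix u x x'))%E.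
  rewrite /h !ge0_integral_distribution//; last exact: msec.
  by congr (_ * _)%E; apply: eq_integral => w _ /=; rewrite join_subvec.
have mG := measurable_integral_mix mu u mF F0.
rewrite [X in (_ <= X)%E]ge0_integral_distribution//.
rewrite [X in (_ <= X)%E](_ : _ =
    \int[mu]_x' (h \o subvec (~: u)) x')%E; last first.
  by rewrite [RHS]ge0_integral_distribution// => x; exact: h_ge0.
under [X in (_ <= X)%E]eq_integral do rewrite /= hE.
rewrite ge0_integralZl// ?lee_fin ?(ltW M0)//.
by move=> x' _; exact: integral_ge0.
Qed.

End density_bound.

(** * The spaces of functions of some coordinates *)

Section spaces.
Context d (Omega : measurableType d) (R : realType) (P : probability Omega R).
Context (p : nat) (X : {RV P >-> p.-tuple R}).
Implicit Types (u v : {set 'I_p}) (x : p.-tuple R).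
Local Notation mu := (distribution P X).
Local Notation L2 := (L2 mu).
Local Notation B := (L2_inner mu).

Definition depends_on u (h : p.-tuple R -> R) :=
  forall x x', (forall i, i \in u -> tnth x i = tnth x' i) -> h x = h x'.

Lemma depends_on_sub u v h : u \subset v -> depends_on u h -> depends_on v h.
Proof.
by move=> /fintype.subsetP uv hu x x' xx'; apply: hu => i /uv; exact: xx'.
Qed.

Lemma depends_on_mix u v h x' : depends_on v h ->
  depends_on (u :&: v) (fun x => h (mix u x x')).
Proof.
move=> hv x y xy; apply: hv => i iv; rewrite !tnth_mktuple.
by case: ifPn => // iu; apply: xy; rewrite finset.inE iu.
Qed.

Lemma mix_depends_on u h x x' : depends_on u h -> h (mix u x x') = h x.
Proof. by move=> hu; apply: hu => i iu; rewrite tnth_mktuple iu. Qed.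

(** Factoring through subvec u can be tested on points: for h depending only on
    the coordinates in u, a factor is obtained by filling the other coordinates
    with 0, which keeps it measurable. *)
Lemma HspaceE u h : Hspace X u h <-> h \in Lfun mu 2%:E /\ depends_on u h.
Proof.
split=> [[hL [g mg hE]]|[hL hu]].
  rewrite hE in hL *; split => // x x' xx'.
  rewrite /= (_ : subvec u x = subvec u x')//.
  apply/eq_from_tnth => j.
  by rewrite !tnth_mktuple; apply: xx'; exact: enum_valP.
split => //; pose z := [tuple (0 : R) | _ < #|~: u|].
exists (fun y => h (@join R p u (y, z))).
  have /L2_memP[mh _] := hL.
  apply: (measurableT_comp mh).
  exact: measurableT_comp (@measurable_join R p u) (measurable_pair2 z).
apply/funext => x /=; apply: hu => i iu.
by rewrite tnth_mktuple iu coord_subvec.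
Qed.

Lemma inner_L2E (f g : L2) : inner X f g = (B f g)%:E.
Proof.
rewrite /inner unlock L2_innerE integral_distribution//.
- by apply: measurable_int (L2_integrableM f g).
- have /integrableP[mfg fg] := L2_integrableM f g.
  apply/integrableP; split.
    exact: measurableT_comp mfg (measurable_funPT X).
  rewrite -(@ge0_integral_distribution _ _ _ _ _ P X
    (fun x => `|(f x * g x)%:E|%E))//.
  exact: measurableT_comp.
Qed.

Definition L2space u : set L2 := [set f | depends_on u f].
Definition L2space0 u : set L2 := [set f | Hspace0 X u f].

Lemma L2space_subspace u : lin_subspace (L2space u).
Proof.
split=> [x x' _|a f g fu gu x x' xx']; first by rewrite !L20.
by rewrite !L2D !L2Z (fu _ _ xx') (gu _ _ xx').
Qed.

Lemma L2space_complete u : scomplete B (L2space u).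
Proof.
move=> f C fu /L2_fast_limit[y yE fy]; exists y; last by exists (C * 2).
move=> x x' xx'; rewrite yE /seq_limit; congr fine; congr limn_esup.
by apply/funext => n; rewrite (fu n _ _ xx').
Qed.

Lemma L2space_mono u v : u \subset v -> L2space u `<=` L2space v.
Proof. by move=> uv f; exact: depends_on_sub. Qed.

Lemma L2space0E u : L2space0 u = [set f | L2space u f /\
  forall v : {set 'I_p}, v \proper u -> forall g, L2space0 v g -> B f g = 0].
Proof.
apply/seteqP; split => f; rewrite /L2space0/= Hspace0E.
  move=> [/HspaceE[fL fu] fO]; split => // v vu g gv.
  by apply: EFin_inj; rewrite -inner_L2E; exact: fO gv.
move=> [fu fO]; split; first by apply/HspaceE; split => //; exact: LfunP.
move=> v vu g gv.
have gL : g \in Lfun mu 2%:E by move: gv; rewrite Hspace0E => -[/HspaceE[]].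
have [g' g'E] := L2_lift gL.
rewrite -g'E inner_L2E; apply: (congr1 EFin); apply: (fO v vu).
by rewrite /L2space0/= g'E.
Qed.

Context (nu : 'I_p -> {sigma_finite_measure set R -> \bar R}).
Context (M : R) (M0 : 0 < M).
Context (mix_le : forall u (F : p.-tuple R -> \bar R),
  measurable_fun setT F -> (forall x, 0 <= F x)%E ->
  (M%:E * \int[mu]_x' \int[mu]_x F (mix u x x') <= \int[mu]_x F x)%E).

(** Freezing in f the coordinates outside u leaves, for almost every frozen
    value, a square integrable function: by the mixing inequality the square
    norms of these sections have a finite integral. *)
Lemma mix_section_L2 u (f : L2) :
  {ae mu, forall x', (fun x => f (mix u x x')) \in Lfun mu 2%:E}.
Proof.
pose F x := (f x ^+ 2)%:E.
have mF : measurable_fun setT F.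
  by apply/measurable_EFinP; apply: measurable_funX; exact: L2_measurable.
have F0 x : (0 <= F x)%E by rewrite lee_fin sqr_ge0.
pose G x' := (\int[mu]_x F (mix u x x'))%E.
have G0 x' : (0 <= G x')%E by apply: integral_ge0 => x _; exact: F0.
have Gint : mu.-integrable setT G.
  apply/integrableP; split; first exact: measurable_integral_mix.
  under eq_integral do rewrite gee0_abs//.
  have := mix_le u mF F0; rewrite -L2_inner_sqr muleC -lee_pdivlMr//.
  by move=> /le_lt_trans; apply; rewrite -EFinM ltry.
apply: filterS (integrable_ae measurableT Gint) => x' /(_ I) Gfin.
apply/L2_memP; split; last by rewrite -ge0_fin_numE ?Gfin //; exact: G0.
exact: measurable_mix_section (L2_measurable f).
Qed.

(** The mixing inequality applied to the square of s = a + \sum_v b v bounds the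
    square norm of s below by M times the average over x' of the square norm of
    x |-> s (mix u x x'). There a is unchanged, while b v becomes a function of
    the coordinates in u :&: v, a strict subset of u, hence orthogonal to a; so
    each of these square norms is at least that of a. *)
Lemma L2space_wide_angle : wide_angle B L2space M.
Proof.
move=> u a b au aO bH; set s := a + _.
have good : {ae mu, forall x' v, (fun x => b v (mix u x x')) \in Lfun mu 2%:E}.
  by apply: filter_forall => v; exact: mix_section_L2.
pose F x := (s x ^+ 2)%:E.
have mF : measurable_fun setT F.
  by apply/measurable_EFinP; apply: measurable_funX; exact: L2_measurable.
have F0 x : (0 <= F x)%E by rewrite lee_fin sqr_ge0.
rewrite -lee_fin EFinM L2_inner_sqr.
rewrite L2_inner_sqr.
apply: le_trans (mix_le u mF F0).
rewrite -L2_inner_sqr lee_pmul2l ?lte_fin//.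
rewrite -[leLHS]mule1 -(@probability_setT _ _ _ mu) -integral_cst//.
apply: ae_ge0_le_integral => //.
- by move=> x' _; rewrite lee_fin form_ge0.
- by move=> x' _; apply: integral_ge0 => x _; exact: F0.
- exact: measurable_integral_mix.
apply: filterS good => x' bx' _.
pose e v : L2 := sval (L2_lift (bx' v)).
have eE v x : e v x = b v (mix u x x').
  by rewrite /e; case: (L2_lift _) => /= g ->.
pose r := \sum_(v : {set 'I_p} | ~~ (u \subset v)) e v.
rewrite (_ : integral _ _ _ = (B (a + r) (a + r))%:E); last first.
  rewrite L2_inner_sqr; apply: eq_integral => x _; rewrite /F /s !L2D.
  rewrite (mix_depends_on _ _ au) !L2_sum.
  by under [in RHS]eq_bigr do rewrite eE.
rewrite lee_fin form_sqrD.
have -> : B a r = 0.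
  rewrite form_sumr big1// => v uv; apply: (aO (u :&: v)).
    rewrite finset.properEneq finset.subsetIl andbT.
    by apply/eqP => /finset.setIidPl; apply/negP.
  move=> x y xy; rewrite !eE; exact: depends_on_mix (bH v uv) _ _ xy.
by rewrite mulr0 addr0 lerDl form_ge0.
Qed.

End spaces.

Theorem theorem1 (d : measure_display) (Omega : measurableType d) (R : realType)
    (P : probability Omega R) (p : nat) (p_gt0 : (0 < p)%N)
    (X : {RV P >-> p.-tuple R})
    (nu : 'I_p -> {sigma_finite_measure set R -> \bar R})
    (PX_ll_nu : distribution P X `<< tprod nu)
    (M : R) (M_gt0 : 0 < M) (M_le1 : M <= 1)
    (pX_ge : forall u : {set 'I_p},
       {ae tprod nu, forall x : p.-tuple R,
          (M%:E * (marginal_density X nu u (subvec u x) *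
                   marginal_density X nu (~: u) (subvec (~: u) x))
           <= density P X (tprod nu) x)%E})
    (eta : p.-tuple R -> R) (eta_L2 : eta \in Lfun (distribution P X) 2%:E) :
  exists2 eta_ : {set 'I_p} -> p.-tuple R -> R,
    (forall u, Hspace0 X u (eta_ u)) /\
    {ae distribution P X, forall x, eta x = \sum_(u : {set 'I_p}) eta_ u x}
    & forall eta' : {set 'I_p} -> p.-tuple R -> R,
        (forall u, Hspace0 X u (eta' u)) ->
        {ae distribution P X, forall x, eta x = \sum_(u : {set 'I_p}) eta' u x} ->
        forall u, {ae distribution P X, forall x, eta' u x = eta_ u x}.
Proof.
pose mu := distribution P X.
have angle : wide_angle (L2_inner mu) (@L2space _ _ _ P _ X) M.
  apply: L2space_wide_angle => // u F mF F0.
  exact: (mix_integral_le PX_ll_nu M_gt0 (pX_ge u)).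
have [e eE] := L2_lift eta_L2.
have eT : L2space (X := X) [set: 'I_p]%SET e.
  move=> x x' xx'; rewrite (_ : x = x')//; apply/eq_from_tnth => i; apply: xx'.
  by rewrite finset.inE.
have sub := L2space_subspace X.
have comp := @L2space_complete _ _ _ _ _ X.
have mono := @L2space_mono _ _ _ _ _ X.
have [a aH ea] := hoeffding_ex sub comp mono
  (L2space0E X) M_gt0 angle eT.
have a0 u : L2space0 (X := X) u (a u).
  by apply: aH; rewrite finset.inE finset.subsetT.
have eta_sum x : eta x = \sum_(u : {set 'I_p}) a u x.
  rewrite -eE ea L2_sum; apply: eq_bigl => u.
  by rewrite finset.inE finset.subsetT.
exists (fun u => (a u : L2 mu)) => [|eta' eta'0 eta'_sum u].
  by split => //; exact: aeW.
have L2' v : eta' v \in Lfun mu 2%:E.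
  by have := eta'0 v; rewrite Hspace0E => -[/HspaceE[]].
pose b v : L2 mu := sval (L2_lift (L2' v)).
have bE v : b v = eta' v :> (p.-tuple R -> R) by rewrite /b; case: (L2_lift _).
have b0 v : L2space0 (X := X) v (b v) by rewrite /L2space0/= bE.
have d0 v : L2space0 (X := X) v (b v - a v).
  by apply: (subspaceB (H0_subspace sub (L2space0E X) v)).
have := hoeffding_unique sub comp mono (L2space0E X)
  M_gt0 angle d0.
have s0 : L2_inner mu (\sum_v (b v - a v)) (\sum_v (b v - a v)) = 0.
  apply/L2_inner_eq0; apply: filterS eta'_sum => x.
  rewrite eta_sum L2_sum => sumE.
  under eq_bigr do rewrite L2D L2N bE.
  by rewrite sumrB -sumE subrr.
move=> /(_ s0 u)/L2_inner_eq0; apply: filterS => x.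
by rewrite L2D L2N bE => /eqP; rewrite subr_eq0 => /eqP.
Qed.
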